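(* Fix a prime power $q$ and an integer $k\ge1$. For every $\delta>0$ there exists a constant $c(\delta)>0$ such that for every $N\ge k$ and every function $\phi:\mathbb{F}_{q^N}\to\mathbb{R}$ with $0\le\phi(x)\le1$ for all $x$ and $\mathbb{E}(\phi\mid \mathbb{F}_{q^N})\ge\delta$, we have $$\mathbb{E}\Big(\prod_{P\in\mathbf{G}_k}\phi(f+Pg)\ \Big|\ f,g\in\mathbb{F}_{q^N}\Big)\ge c(\delta).$$
   Context: $\mathbf{G}_N$ denotes the set of polynomials in $\mathbb{F}_q[t]$ of degree less than $N$. For each $N$ a monic irreducible polynomial $f_N\in\mathbb{F}_q[t]$ of degree $N$ is fixed, and $\mathbb{F}_{q^N}$ denotes the additive group $\mathbf{G}_N$ endowed with multiplication modulo $f_N$ (a field with $q^N$ elements); for $N\ge k$, $\mathbf{G}_k\subseteq\mathbf{G}_N=\mathbb{F}_{q^N}$. $\mathbb{E}(\cdot\mid A)$ denotes the average over the finite set $A$. *)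

(* Defs.v *)
From HB Require Import structures.
From mathcomp Require Import all_boot all_order all_algebra.
From mathcomp Require Import reals.
Set Implicit Arguments. Unset Strict Implicit. Unset Printing Implicit Defensive.
Import Order.TTheory GRing.Theory Num.Theory.
Local Open Scope ring_scope.

(* G_N is represented by coefficient vectors {ffun 'I_N -> F}:
   polyG a = sum_{i<N} a i t^i, a polynomial of degree < N. *)
Definition polyG (F : finFieldType) (N : nat) (a : {ffun 'I_N -> F}) : {poly F} :=
  \poly_(i < N) (if insub i is Some j then a j else 0).

Definition ofPoly (F : finFieldType) (N : nat) (p : {poly F}) : {ffun 'I_N -> F} :=
  [ffun i : 'I_N => p`_i].

Definition avg (T : finType) (R : realType) (h : T -> R) : R :=
  (\sum_(x : T) h x) / (#|T|%:R).

(* Main.v *)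
Require Import Defs.
From HB Require Import structures.
From mathcomp Require Import classical_sets.
From mathcomp Require Import all_boot all_order all_algebra.
From mathcomp Require Import reals lra.
Import Order.TTheory GRing.Theory Num.Theory.
Local Open Scope ring_scope.
Set Implicit Arguments.
Unset Strict Implicit.
Unset Printing Implicit Defensive.

(** The pattern [f + P g] is the image of a combinatorial line over the finite
    alphabet [G_k]: for elements [d_1, ..., d_n] of the field, the map
    [x |-> f + x_1 d_1 + ... + x_n d_n] from [G_k^n] sends a line with wildcard
    set [W] to such a pattern with [g] the sum of the [d_i], [i] in [W].  When
    [f, d_1, ..., d_n] are uniform, so is the pair attached to a given line, so
    the density Hales-Jewett theorem, applied for a fixed [n] to the many choices
    of [f, d_1, ..., d_n] for which the preimage of [{phi >= delta / 2}] is
    dense, bounds the average from below uniformly in [N].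

    The density Hales-Jewett theorem is proved by induction on the alphabet,
    passing from [K] to [option K], with a density increment in the style of
    Polymath and Dodos-Kanellopoulos-Tyros.  Let [d] be the infimum of the
    densities forcing a line, and suppose [d > 0].  If [A] has density close to
    [d] and no line, then all its sections over a bounded number of coordinates
    have density close to [d].  The theorem for [K] gives many words [x] over
    [option K], that is, lines over [K], all of whose [K]-points lie in a common
    section of [A].  These [x] form an intersection [D] of sets, the [a]-th of
    which does not distinguish the letter [a] from [None]; as [A] has no line it
    almost avoids [D], so it is denser than [d] on the complement of [D].  By the
    theorem for [K], that complement is almost covered by large subspaces, and
    on one of them the density of [A] exceeds [d] by a fixed amount. *)

(** * Averages over finite types *)

Section Averages.
Variable R : realType.
Implicit Types T U : finType.

Lemma eq_avg T (f g : T -> R) : f =1 g -> avg f = avg g.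
Proof. by move=> fg; rewrite /avg; congr (_ / _); apply: eq_bigr. Qed.

Lemma le_avg T (f g : T -> R) : (forall x, f x <= g x) -> avg f <= avg g.
Proof.
by move=> fg; rewrite /avg ler_wpM2r ?invr_ge0 ?ler0n// ler_sum.
Qed.

Lemma avgD T (f g : T -> R) : avg (fun x => f x + g x) = avg f + avg g.
Proof. by rewrite /avg big_split mulrDl. Qed.

Lemma avgMl T c (f : T -> R) : avg (fun x => c * f x) = c * avg f.
Proof. by rewrite /avg -mulr_sumr mulrA. Qed.

Lemma avgB T (f g : T -> R) : avg (fun x => f x - g x) = avg f - avg g.
Proof. by rewrite /avg sumrB mulrBl. Qed.

Lemma avg_cst T (x0 : T) (c : R) : avg (fun _ : T => c) = c.
Proof.
have T0 : (0 < #|T|)%N by apply/card_gt0P; exists x0.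
by rewrite /avg sumr_const -[c *+ _]mulr_natr mulfK // pnatr_eq0 -lt0n.
Qed.

Lemma avg_ge0 T (f : T -> R) : (forall x, 0 <= f x) -> 0 <= avg f.
Proof. by move=> f0; rewrite divr_ge0 ?ler0n ?sumr_ge0. Qed.

Lemma avg_le T (f : T -> R) (c : R) (x0 : T) :
  (forall x, f x <= c) -> avg f <= c.
Proof. by move=> fc; rewrite -(avg_cst x0 c) le_avg. Qed.

Lemma avg_ge T (f : T -> R) (c : R) (x0 : T) :
  (forall x, c <= f x) -> c <= avg f.
Proof. by move=> fc; rewrite -[leLHS](avg_cst x0 c) le_avg. Qed.

Lemma exists_ge_avg T (x0 : T) (f : T -> R) c : c <= avg f -> exists x, c <= f x.
Proof.
move=> cf; have [/existsP[x cx]|/existsPn lt_c] := boolP [exists x, c <= f x].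
  by exists x.
have T0 : 0 < #|T|%:R :> R by rewrite ltr0n; apply/card_gt0P; exists x0.
have : \sum_x f x < \sum_(x : T) c.
  apply: ltr_sum; first by apply/hasP; exists x0; rewrite ?mem_index_enum.
  by move=> x _; rewrite ltNge lt_c.
by move: cf; rewrite /avg ler_pdivlMr // sumr_const -[c *+ _]mulr_natr leNgt => /negP.
Qed.

Lemma avg_bij T U (s : T -> U) (f : U -> R) :
  bijective s -> avg (fun x => f (s x)) = avg f.
Proof.
move=> s_bij; rewrite /avg (bij_eq_card s_bij); congr (_ / _).
by rewrite [RHS](reindex s) //; apply: onW_bij.
Qed.

Lemma avg_pair T U (f : T * U -> R) : avg f = avg (fun x => avg (fun y => f (x, y))).
Proof.
rewrite /avg -mulr_suml pair_bigA /= card_prod natrM invfM -[RHS]mulrA.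
by rewrite [X in _ = _ * X]mulrC; congr (_ * _); apply: eq_bigr => -[].
Qed.

Lemma avg_exchange T U (f : T -> U -> R) :
  avg (fun x => avg (f x)) = avg (fun y => avg (fun x => f x y)).
Proof.
rewrite -(avg_pair (fun p => f p.1 p.2)).
rewrite -(avg_pair (fun p => f p.2 p.1)).
pose s (p : T * U) := (p.2, p.1).
have s_bij : bijective s by exists (fun p => (p.2, p.1)) => -[].
by rewrite -(avg_bij _ s_bij).
Qed.

Lemma avg_sum (I : Type) (r : seq I) (P : pred I) T (f : I -> T -> R) :
  avg (fun x => \sum_(i <- r | P i) f i x) = \sum_(i <- r | P i) avg (f i).
Proof. by rewrite /avg exchange_big /= mulr_suml. Qed.

(** An involution preserves the uniform measure on [T * U], so the first component of [s (x, y)] is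
    again uniform. This is the source of [avg_insertion] and [avg_remix]. *)
Lemma avg_swap T U (u0 : U) (s : T * U -> T * U) (f : T -> R) :
  involutive s -> avg f = avg (fun x => avg (fun y => f (s (x, y)).1)).
Proof.
move=> sK; rewrite -(avg_pair (fun p => f (s p).1)).
rewrite (avg_bij (fun p => f p.1) (inv_bij sK)) avg_pair.
by apply: eq_avg => x /=; rewrite avg_cst.
Qed.

(** Markov's argument: points with [f x < d / 2] contribute at most [d / 2] to the average, and the
    others at most their own density, as [f <= 1]. *)
Lemma avg_popular T (f : T -> R) (d : R) :
  (forall x, f x <= 1) -> d <= avg f -> d / 2 <= avg (fun x => (d / 2 <= f x)%R%:R).
Proof.
move=> f1 df; case: (pickP (fun _ : T => true)) => [x0 _|T0]; last first.
  have e0 (g : T -> R) : avg g = 0 by rewrite /avg big_pred0 ?mul0r.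
  by move: df; rewrite !e0; lra.
have [d0|d0] := lerP d 0.
  by apply: le_trans (avg_ge0 _); [lra|move=> x; rewrite ler0n].
suff : avg f <= avg (fun x => (d / 2 <= f x)%R%:R) + d / 2 by lra.
rewrite -[X in _ + X](avg_cst x0) -avgD le_avg // => x.
by have := f1 x; case: (lerP (d / 2) (f x)) => /= ? ?; lra.
Qed.

Lemma exists_pigeonhole T U (x0 : T) (P : T -> U -> bool) (d : R) : 0 < d ->
  d <= avg (fun x => [exists y, P x y]%:R) ->
  exists y, d / #|U|%:R <= avg (fun x => (P x y)%:R).
Proof.
move=> d0 dP.
have [x /existsP[y0 _]] : exists x, [exists y, P x y].
  have [x dx] := exists_ge_avg x0 dP; exists x.
  by apply: contraTT d0 => /negbTE Px; move: dx; rewrite Px /= -leNgt.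
have U0 : 0 < #|U|%:R :> R by rewrite ltr0n; apply/card_gt0P; exists y0.
apply: (exists_ge_avg y0 (f := fun y => avg (fun x => (P x y)%:R))).
rewrite [leRHS]/avg ler_pM2r ?invr_gt0 //.
apply: le_trans dP _; rewrite -avg_sum le_avg // => {x0 x y0}x.
have [/existsP[y Pxy]|_] := boolP [exists y, P x y]; last by rewrite sumr_ge0.
by rewrite (bigD1 y) //= Pxy lerDl sumr_ge0.
Qed.

End Averages.

(** * Words, combinatorial lines and subspaces *)

Section Words.
Implicit Types I J K X S : finType.

(** [None] is the wildcard; that it occurs is required separately, in [DHJ]. *)
Definition line K I (l : {ffun I -> option K}) (a : K) : {ffun I -> K} :=
  [ffun i => odflt a (l i)].

(** [inl a] is a frozen letter and [inr j] a copy of the free coordinate [j]. *)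
Definition subspace K I J (w : {ffun I -> K + J}) (x : {ffun J -> K}) :
    {ffun I -> K} :=
  [ffun i => match w i with inl a => a | inr j => x j end].

Definition nondeg K I J (w : {ffun I -> K + J}) :=
  forall j, exists i, w i = inr j.

Lemma subspace_inj K I J (w : {ffun I -> K + J}) :
  nondeg w -> injective (subspace w).
Proof.
move=> wn x y /ffunP xy; apply/ffunP => j.
by have [i wi] := wn j; have := xy i; rewrite !ffunE wi.
Qed.

Definition subspace_comp K I J X
    (w : {ffun I -> K + J}) (w' : {ffun J -> K + X}) : {ffun I -> K + X} :=
  [ffun i => match w i with inl a => inl a | inr j => w' j end].

Lemma subspace_compE K I J X (w : {ffun I -> K + J}) (w' : {ffun J -> K + X}) x :
  subspace (subspace_comp w w') x = subspace w (subspace w' x).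
Proof. by apply/ffunP => i; rewrite !ffunE; case: (w i) => // j; rewrite ffunE. Qed.

Lemma subspace_comp_nondeg K I J X
    (w : {ffun I -> K + J}) (w' : {ffun J -> K + X}) :
  nondeg w -> nondeg w' -> nondeg (subspace_comp w w').
Proof.
move=> wn wn' c; have [j jc] := wn' c; have [i ij] := wn j.
by exists i; rewrite ffunE ij.
Qed.

Definition subspace_line K I J (w : {ffun I -> K + J}) (l : {ffun J -> option K}) :
    {ffun I -> option K} :=
  [ffun i => match w i with inl a => Some a | inr j => l j end].

Lemma subspace_lineE K I J (w : {ffun I -> K + J}) (l : {ffun J -> option K}) a :
  line (subspace_line w l) a = subspace w (line l a).
Proof. by apply/ffunP => i; rewrite !ffunE; case: (w i) => // j; rewrite ffunE. Qed.

Definition insertion K I J (e : J -> I) (u : {ffun I -> K}) : {ffun I -> K + J} :=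
  [ffun i => if [pick j | e j == i] is Some j then inr j else inl (u i)].

Lemma insertionE K I J (e : J -> I) (u : {ffun I -> K}) j : injective e ->
  insertion e u (e j) = inr j.
Proof.
move=> e_inj; rewrite ffunE; case: pickP => [j' /eqP/e_inj-> //|/(_ j)].
by rewrite eqxx.
Qed.

Lemma insertion_nondeg K I J (e : J -> I) (u : {ffun I -> K}) :
  injective e -> nondeg (insertion e u).
Proof. by move=> e_inj j; exists (e j); apply: insertionE. Qed.

Definition join K I J X (g : I -> J + X) (x : {ffun J -> K}) (y : {ffun X -> K}) :
    {ffun I -> K} :=
  [ffun i => match g i with inl j => x j | inr j => y j end].

Lemma exists_split I J : (#|J| <= #|I|)%N ->
  exists (X : finType) (g : I -> J + X), bijective g /\ #|X| = (#|I| - #|J|)%N.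
Proof.
move=> le_JI; have eq_card : #|I| = #|{: J + 'I_(#|I| - #|J|)}|.
  by rewrite card_sum card_ord subnKC.
exists 'I_(#|I| - #|J|), (fun i => enum_val (cast_ord eq_card (enum_rank i))).
split; last by rewrite card_ord.
exists (fun s => enum_val (cast_ord (esym eq_card) (enum_rank s))) => i.
  by rewrite enum_valK cast_ordK enum_rankK.
by rewrite enum_valK cast_ordKV enum_rankK.
Qed.

(** Redraws the letters of [w] lying in the range of [g]. It serves to view a uniform word over [K]
    as a random set of positions that carries an independent uniform word over the smaller alphabet
    [X]. *)
Definition remix S X K (g : X -> K) (w : {ffun S -> K}) (x : {ffun S -> X}) :
    {ffun S -> K} :=
  [ffun p => if w p \in codom g then g (x p) else w p].

End Words.

(** * Resampling uniform words *)

Section WordAverages.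
Variable R : realType.
Implicit Types I J K X S : finType.

Lemma avg_insertion K I J (k0 : K) (e : J -> I) (f : {ffun I -> K} -> R) :
  injective e ->
  avg f = avg (fun u => avg (fun x => f (subspace (insertion e u) x))).
Proof.
move=> e_inj.
(* This involution exchanges [x] with the letters of [u] along [e]. *)
pose s (p : {ffun I -> K} * {ffun J -> K}) :=
  (subspace (insertion e p.1) p.2, [ffun j => p.1 (e j)]).
apply: (avg_swap [ffun=> k0] (s := s)) => -[u x]; congr (_, _) => /=; last first.
  by apply/ffunP => j; rewrite ffunE ffunE insertionE.
apply/ffunP => i; rewrite !ffunE; case: pickP => [j /eqP<-|//].
by rewrite ffunE.
Qed.

Lemma avg_join K I J X (g : I -> J + X) (f : {ffun I -> K} -> R) : bijective g ->
  avg f = avg (fun x => avg (fun y => f (join g x y))).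
Proof.
case=> h gh hg; rewrite -(avg_pair (fun p => f (join g p.1 p.2))).
rewrite (avg_bij (s := fun p => join g p.1 p.2)) //.
exists (fun z : {ffun I -> K} => ([ffun j => z (h (inl j))], [ffun j => z (h (inr j))])).
  by move=> [x y]; congr (_, _); apply/ffunP => j; rewrite !ffunE /= hg.
move=> z; apply/ffunP => i; rewrite !ffunE.
by case gi: (g i) => [j|j]; rewrite ffunE -gi gh.
Qed.

Lemma avg_remix S X K (x0 : X) (g : X -> K) (f : {ffun S -> K} -> R) :
  injective g -> avg f = avg (fun w => avg (fun x => f (remix g w x))).
Proof.
move=> g_inj.
(* This involution exchanges [x] with the [g]-preimages of the letters of [w], wherever these
   exist. *)
pose s (p : {ffun S -> K} * {ffun S -> X}) := (remix g p.1 p.2,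
  [ffun i => if [pick a | g a == p.1 i] is Some a then a else p.2 i]).
have mem_g (b : K) : (b \in codom g) = [exists a, g a == b].
  apply/codomP/existsP => [[a ->]|[a /eqP<-]]; first by exists a.
  by exists a.
apply: (avg_swap [ffun=> x0] (s := s)) => -[w x]; congr (_, _) => /=.
  apply/ffunP => i; rewrite !ffunE; case: pickP => [a /eqP<-|gi].
    by rewrite codom_f /= codom_f.
  suff -> : (w i \in codom g) = false by case: ifP => // /codomP[a wa];
    have := gi a; rewrite wa eqxx.
  by rewrite mem_g; apply/existsP => -[a]; rewrite gi.
apply/ffunP => i; rewrite !ffunE mem_g; case: existsP => [_|nex].
  by case: pickP => [a /eqP/g_inj->|/(_ (x i))] //; rewrite eqxx.
by case: pickP => [a wa|//]; case: nex; exists a.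
Qed.

Lemma expr_decay (rho c eps : R) : 0 <= rho -> rho < 1 -> 0 < eps ->
  exists b, c * rho ^+ b <= eps.
Proof.
move=> rho0 rho1 eps0.
have [c0|c0] := lerP c 0.
  by exists 0; rewrite expr0; lra.
have bernoulli b : rho ^+ b * (1 + b%:R * (1 - rho)) <= 1.
  elim: b => [|b IH]; first by rewrite expr0; lra.
  apply: le_trans IH; rewrite exprS mulrAC [leRHS]mulrC ler_wpM2r ?exprn_ge0 //.
  have : 0 <= b.+1%:R * ((1 - rho) * (1 - rho)).
    by rewrite !mulr_ge0 ?ler0n ?subr_ge0 ?(ltW rho1).
  rewrite -natr1; move: (b%:R) => t.
  by lra.
have k0 : 0 < eps * (1 - rho) by rewrite mulr_gt0 // subr_gt0.
pose x := c / (eps * (1 - rho)).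
have x0 : 0 <= x by rewrite divr_ge0 // ltW.
exists (Num.bound x); have := archi_boundP x0; set b := Num.bound x.
rewrite /x ltr_pdivrMr // => xb.
have d0 : 0 < 1 + b%:R * (1 - rho).
  by rewrite ltr_pwDl // mulr_ge0 ?ler0n ?subr_ge0 // ltW.
rewrite -(ler_pM2r d0) -mulrA.
apply: (@le_trans _ _ c).
  by rewrite -[leRHS]mulr1 ler_wpM2l ?bernoulli // ltW.
by lra.
Qed.

(** [S] consists of [n] blocks of equal length. If every block meets [P], there are at least [n]
    occurrences; a given block misses [P] with exponentially small probability, and a union bound
    over the blocks concludes. *)
Lemma rare_few_occurrences K n (eps : R) : 0 < eps ->
  exists S : finType, (n <= #|S|)%N /\
    forall P : pred K, (exists a, P a) ->
      avg (fun x : {ffun S -> K} => (#|[pred p | P (x p)]| < n)%N%:R) <= eps.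
Proof.
move=> eps0.
have [K0|K0] := posnP #|K|.
  exists 'I_n; split; first by rewrite card_ord.
  by move=> P [a]; have := fintype0 a K0.
pose rho : R := 1 - #|K|%:R^-1.
have K0R : 0 < #|K|%:R :> R by rewrite ltr0n.
have KV0 : 0 < #|K|%:R^-1 :> R by rewrite invr_gt0.
have KV1 : #|K|%:R^-1 <= 1 :> R by rewrite invf_le1 // ler1n.
have [b /= hb] : exists b, n%:R * rho ^+ b <= eps.
  by apply: expr_decay => //; rewrite /rho; lra.
have rho0 : 0 <= rho by rewrite /rho; lra.
exists ('I_n * 'I_b.+1)%type; split.
  by rewrite card_prod !card_ord leq_pmulr.
move=> P [a Pa].
apply: (@le_trans _ _ (\sum_(c < n) avg (fun x : {ffun 'I_n * 'I_b.+1 -> K} =>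
    [forall d, ~~ P (x (c, d))]%:R))).
  rewrite -avg_sum le_avg // => x; case: ltnP => //= lt_n; last by rewrite sumr_ge0.
  have [/existsP[c Pc]|/existsPn all_c] := boolP [exists c, [forall d, ~~ P (x (c, d))]].
    by rewrite (bigD1 c) //= Pc lerDl sumr_ge0.
  suff : (n <= #|[pred p | P (x p)]|)%N by rewrite leqNgt lt_n.
  rewrite -[leqLHS]card_ord; set D := [pred p | _].
  rewrite (leq_trans _ (leq_imset_card fst D)) // subset_leq_card //.
  apply/subsetP => c _; have /forallPn[d /negPn Pd] := all_c c.
  by apply/imsetP; exists (c, d).
apply: le_trans hb; rewrite mulr_natl -[X in _ *+ X]card_ord -sumr_const.
apply: ler_sum => c _.
have e_inj : injective (fun d : 'I_b.+1 => (c, d)) by move=> d d' [].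
rewrite (avg_insertion a _ e_inj).
apply: (avg_le [ffun=> a]) => u.
rewrite (eq_avg (g := fun v : {ffun 'I_b.+1 -> K} => (v \in ffun_on (predC P))%:R)); last first.
  move=> v; congr (_%:R); congr nat_of_bool.
  by apply/forallP/ffun_onP => h d; have := h d; rewrite ffunE insertionE.
rewrite /avg -natr_sum -big_mkcond sum1_card card_ffun_on card_ffun card_ord.
rewrite !natrX -expr_div_n.
apply: (@le_trans _ _ (rho ^+ b.+1)).
  rewrite lerXn2r ?nnegrE ?divr_ge0 ?ler0n // /rho.
  rewrite ler_pdivrMr // mulrBl mul1r mulVf ?gt_eqF // lerBrDr natr1 ler_nat.
  by rewrite -[leqRHS](cardC P) -add1n leq_add2r; apply/card_gt0P; exists a.
by rewrite exprS ler_piMl ?exprn_ge0 // /rho; lra.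
Qed.

End WordAverages.

(** * Products of subspaces, and insensitive sets *)

Section Subspaces.
Implicit Types I J K X S : finType.

Lemma subspace_join K I J X S (g : I -> J + X)
    (w1 : {ffun J -> K + S}) (w2 : {ffun X -> K + S}) x :
  subspace (join g w1 w2) x = join g (subspace w1 x) (subspace w2 x).
Proof. by apply/ffunP => i; rewrite !ffunE; case: (g i) => j; rewrite ffunE. Qed.

(** Joined with a nondegenerate word on a complementary block, this frozen word gives a subspace
    inside a single section. *)
Definition const_subspace K I J (x : {ffun I -> K}) : {ffun I -> K + J} :=
  [ffun i => inl (x i)].

Lemma subspace_const K I J (x : {ffun I -> K}) (y : {ffun J -> K}) :
  subspace (const_subspace J x) y = x.
Proof. by apply/ffunP => i; rewrite !ffunE. Qed.

Lemma join_nondegl K I J X S (g : I -> J + X)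
    (w1 : {ffun J -> K + S}) (w2 : {ffun X -> K + S}) :
  bijective g -> nondeg w1 -> nondeg (join g w1 w2).
Proof.
by case=> h _ hg wn s; have [j js] := wn s; exists (h (inl j)); rewrite ffunE hg.
Qed.

Lemma join_nondegr K I J X S (g : I -> J + X)
    (w1 : {ffun J -> K + S}) (w2 : {ffun X -> K + S}) :
  bijective g -> nondeg w2 -> nondeg (join g w1 w2).
Proof.
by case=> h _ hg wn s; have [j js] := wn s; exists (h (inr j)); rewrite ffunE hg.
Qed.

(* Combinatorial lines over [K] are the words over [option K] containing [None];
   the same words serve as points over the alphabet [option K]. *)
Definition fill K I (a : K) (x : {ffun I -> option K}) : {ffun I -> option K} :=
  [ffun i => Some (odflt a (x i))].

(** [fill a] identifies the words that differ only by exchanging [Some a] and [None], so [C] cannot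
    tell these two letters apart. *)
Definition insensitive K I a (C : pred {ffun I -> option K}) :=
  forall x, C (fill a x) = C x.

Lemma insensitive_eq K I a (C : pred {ffun I -> option K}) x y :
  insensitive a C -> fill a x = fill a y -> C x = C y.
Proof. by move=> insC xy; rewrite -insC xy insC. Qed.

Lemma fill_subspace K I J a (w : {ffun I -> option K + J}) x :
  fill a (subspace w (fill a x)) = fill a (subspace w x).
Proof. by apply/ffunP => i; rewrite !ffunE; case: (w i) => // j; rewrite ffunE. Qed.

Lemma fill_joinr K I J X a (g : I -> J + X) (x : {ffun J -> option K}) y :
  fill a (join g x (fill a y)) = fill a (join g x y).
Proof. by apply/ffunP => i; rewrite !ffunE; case: (g i) => // j; rewrite ffunE. Qed.

End Subspaces.

(** * The multidimensional theorem and the covering of insensitive sets *)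

Section DensityHalesJewett.
Variable R : realType.
Implicit Types I J K X S : finType.

(** The density is a parameter so that one can take the infimum of the densities that force a
    line. *)
Definition DHJ K (d : R) := exists n, forall I (A : pred {ffun I -> K}),
  (n <= #|I|)%N -> d <= avg (fun x => (A x)%:R) ->
  exists2 l : {ffun I -> option K}, exists i, l i = None & forall a, A (line l a).

Definition MDHJ K N (d : R) := exists n, forall I (A : pred {ffun I -> K}),
  (n <= #|I|)%N -> d <= avg (fun x => (A x)%:R) ->
  exists2 w : {ffun I -> K + 'I_N}, nondeg w & forall x, A (subspace w x).

Lemma avg_pred_le1 (T : finType) (P : pred T) : avg (fun x : T => (P x)%:R : R) <= 1.
Proof.
have [T0|T0] := posnP #|T|; first by rewrite /avg T0 invr0 mulr0.
have [x0 _] := card_gt0P T0.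
by apply: (avg_le x0) => x; rewrite lern1 leq_b1.
Qed.

(** Induction on the dimension. Split off [n1] coordinates: many sections contain a line there, and
    by pigeonhole one line [l] serves a dense set of [y]. An [N]-dimensional subspace of such [y],
    times [l], has dimension [N.+1]. *)
Lemma mdhj K (k0 : K) : (forall d, 0 < d -> DHJ K d) ->
  forall N d, 0 < d -> MDHJ K N d.
Proof.
move=> dhj; elim=> [|N IHN] d d0.
  exists 0 => I A _ dA; have [x dx] := exists_ge_avg [ffun=> k0] dA.
  exists (const_subspace _ x) => [[]//|y]; rewrite subspace_const.
  by apply: contraTT d0 => /negbTE Ax; move: dx; rewrite Ax /= -leNgt.
have d20 : 0 < d / 2 by lra.
have [n1 hn1] := dhj _ d20.
pose U := {ffun 'I_n1 -> option K}.
have U0 : 0 < #|{: U}|%:R :> R by rewrite ltr0n; apply/card_gt0P; exists [ffun=> None].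
have [n2 hn2] := IHN _ (divr_gt0 d20 U0).
exists (n1 + n2)%N => I A le_n dA.
have [|X [g [g_bij cardX]]] := @exists_split I 'I_n1.
  by rewrite card_ord (leq_trans _ le_n) ?leq_addr.
have le_n2 : (n2 <= #|X|)%N.
  by rewrite cardX card_ord leq_subRL ?(leq_trans _ le_n) ?leq_addr.
move: dA; rewrite (avg_join _ g_bij) avg_exchange => dA.
pose P (y : {ffun X -> K}) (l : U) :=
  [exists i, l i == None] && [forall a, A (join g (line l a) y)].
have dP : d / 2 <= avg (fun y => [exists l, P y l]%:R).
  apply: le_trans (avg_popular _ dA) _.
    by move=> y; apply: (@avg_pred_le1 _ (fun x => A (join g x y))).
  apply: le_avg => y; case: (lerP (d / 2) _) => /= dy; last exact: ler0n.
  rewrite ler_nat lt0b.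
  have [|l [i li] Al] := hn1 _ (fun x => A (join g x y)) _ dy; first by rewrite card_ord.
  apply/existsP; exists l; apply/andP; split; last exact/forallP.
  by apply/existsP; exists i; rewrite li.
have [l dl] := exists_pigeonhole [ffun=> k0] d20 dP.
have [w wn Pw] := hn2 _ (P^~ l) le_n2 dl.
have /andP[/existsP[i0 /eqP li0] _] := Pw [ffun=> k0].
pose v1 : {ffun 'I_n1 -> K + 'I_N.+1} :=
  [ffun i => if l i is Some a then inl a else inr ord0].
pose v2 : {ffun X -> K + 'I_N.+1} :=
  [ffun i => match w i with inl a => inl a | inr c => inr (lift ord0 c) end].
have [h gh hg] := g_bij.
exists (join g v1 v2) => [c|x].
  case: (unliftP ord0 c) => [c' ->|->].
    by have [i wi] := wn c'; exists (h (inr i)); rewrite ffunE hg ffunE wi.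
  by exists (h (inl i0)); rewrite ffunE hg ffunE li0.
have /andP[_ /forallP/(_ (x ord0))] := Pw [ffun c => x (lift ord0 c)].
rewrite subspace_join; congr (A (join _ _ _)); apply/ffunP => i; rewrite !ffunE.
  by case: (l i).
by case: (w i) => // c; rewrite ffunE.
Qed.

(** Fix the positions of [None] in a random word. The other positions carry a uniform word over [K],
    where [MDHJ] finds a subspace whose [K]-points lie in [C]. Insensitivity extends this to all
    points, since a free coordinate equal to [None] may be read as [i]. *)
Lemma dense_insensitive_subspace K (k0 : K) :
  (forall N (d : R), 0 < d -> MDHJ K N d) ->
  forall N (d : R), 0 < d -> exists S, (N <= #|S|)%N /\
    forall i (C : pred {ffun S -> option K}), insensitive i C ->
      d <= avg (fun x => (C x)%:R) ->
      exists2 w : {ffun S -> option K + 'I_N}, nondeg w &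
        forall x, C (subspace w x).
Proof.
move=> md N d d0; have d20 : 0 < d / 2 by lra.
have [n hn] := md N _ d20.
have [S [le_nS rare]] := @rare_few_occurrences R (option K) (maxn n N) _ d20.
exists S; split; first by rewrite (leq_trans _ le_nS) ?leq_maxr.
have Some_K_inj : injective (@Some K) by move=> ? ? [].
move=> i C insC; rewrite (avg_remix k0 _ Some_K_inj) => dC.
have {}rare := rare isSome (ex_intro _ (Some k0) isT).
set f := (fun x => avg _) in dC.
set few := (fun x => _) in rare.
have [x dx] : exists x, d / 2 <= f x - few x.
  by apply: (exists_ge_avg [ffun=> None]); rewrite avgB; lra.
have f1 : f x <= 1 by apply: (@avg_pred_le1 _ (fun z => C (remix _ x z))).
have [le_n df] : (n <= #|[pred p | x p]|)%N /\ d / 2 <= f x.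
  move: dx; rewrite /few; case: ltnP => /= [|le_n]; first by lra.
  by move=> dx; split; [rewrite (leq_trans _ le_n) ?leq_maxl|lra].
pose T : finType := {p | x p}.
move: df; rewrite /f (avg_insertion k0 (e := (val : T -> S))) //; last exact: val_inj.
move=> /(exists_ge_avg [ffun=> k0])[u du].
have [|w0 wn Cw] := hn T
  (fun v => C (remix Some x (subspace (insertion val u) v))) _ du.
  by rewrite card_sig.
pose w : {ffun S -> option K + 'I_N} := [ffun p =>
  if insub p is Some t then
    match w0 t with inl a => inl (Some a) | inr j => inr j end
  else inl None].
exists w => [j|y].
  by have [t tj] := wn j; exists (val t); rewrite ffunE valK tj.
have := Cw [ffun j => odflt i (y j)].
rewrite (insensitive_eq (y := subspace w y) insC) //.
apply/ffunP => p; rewrite ffunE [RHS]ffunE; congr Some; rewrite ffunE [in RHS]ffunE.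
rewrite [w p]ffunE; case: insubP => [t xp tp|xp].
  rewrite ifT; last by case: (x p) xp => // a _; apply: codom_f.
  rewrite /= ffunE -tp insertionE ?ffunE; last exact: val_inj.
  by case: (w0 t) => //= j; rewrite ffunE.
by case: (x p) xp => //= _; case: ifP => // /codomP[].
Qed.

Lemma avg_codom (T U : finType) (h : U -> T) (f : T -> R) : (0 < #|U|)%N ->
  injective h ->
  avg (fun x => f x * (x \in codom h)%:R) = #|U|%:R / #|T|%:R * avg (fun u => f (h u)).
Proof.
move=> U0 h_inj; have U0' : #|U|%:R != 0 :> R by rewrite pnatr_eq0 -lt0n.
rewrite /avg [RHS]mulrC mulrA mulfVK //; congr (_ / _).
transitivity (\sum_(x in codom h) f x).
  by rewrite [RHS]big_mkcond /=; apply: eq_bigr => x _; case: ifP; rewrite ?mulr1 ?mulr0.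
rewrite -big_uniq /=; last by rewrite codomE map_inj_uniq ?enum_uniq.
by rewrite codomE big_map big_enum.
Qed.

(* Splitting off a block of coordinates removes a fixed proportion of
   the excess of the density of [C] over [eps / 2]: the subspaces found in the
   dense sections of [C] are removed, and what is left stays insensitive in the
   other coordinates because the subspace depends on the section only. *)
Lemma insensitive_avg_le K (k0 : K) :
  (forall N (d : R), 0 < d -> MDHJ K N d) ->
  forall N (eps : R), 0 < eps -> exists m,
  forall I i (C : pred {ffun I -> option K}) (f : {ffun I -> option K} -> R),
    (m <= #|I|)%N -> insensitive i C -> (forall x, f x <= 1) ->
    (forall w : {ffun I -> option K + 'I_N}, nondeg w ->
      (forall x, C (subspace w x)) -> avg (fun x => f (subspace w x)) <= 0) ->
    avg (fun x => f x * (C x)%:R) <= eps.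
Proof.
move=> md N eps eps0; have b0 : 0 < eps / 2 by lra.
have [S [le_NS hS]] := dense_insensitive_subspace k0 md N b0.
set b := eps / 2 in b0 hS.
(* The density of an [N]-dimensional subspace inside the block [S]. *)
pose kap : R := #|{: {ffun 'I_N -> option K}}|%:R / #|{: {ffun S -> option K}}|%:R.
have K1 : (0 < #|{: option K}|)%N by apply/card_gt0P; exists None.
have kap0 : 0 < kap.
  by rewrite divr_gt0 // ltr0n card_ffun expn_gt0 K1.
have kap1 : kap <= 1.
  rewrite ler_pdivrMr ?ltr0n ?card_ffun ?expn_gt0 ?K1 // mul1r ler_nat.
  by rewrite card_ord leq_pexp2l.
suff claim j : forall I i (C : pred {ffun I -> option K}) (f : {ffun I -> option K} -> R),
    (j * #|S| <= #|I|)%N -> insensitive i C -> (forall x, f x <= 1) ->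
    (forall w : {ffun I -> option K + 'I_N}, nondeg w ->
      (forall x, C (subspace w x)) -> avg (fun x => f (subspace w x)) <= 0) ->
    avg (fun x => f x * (C x)%:R) <= b + (1 - kap) ^+ j * (avg (fun x => (C x)%:R) - b).
  (* With [(1 - kap) ^+ j <= b], the claim bounds the average by [b + b = eps]. *)
  have [|||j] := @expr_decay R (1 - kap) 1 b; rewrite ?subr_ge0 //.
    by rewrite ltrBlDr ltrDl.
  rewrite mul1r => hj; exists (j * #|S|)%N => I i C f le_j insC f1 fw.
  apply: le_trans (claim j I i C f le_j insC f1 fw) _.
  have C1 : avg (fun x => (C x)%:R : R) <= 1 by apply: avg_pred_le1.
  have := exprn_ge0 j (_ : 0 <= 1 - kap); rewrite subr_ge0 => /(_ kap1).
  move: ((1 - kap) ^+ j) hj => t; rewrite /b in b0 * => tb t0.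
  suff : t * (avg (fun x => (C x)%:R) - eps / 2) <= t * 1 by lra.
  by rewrite ler_wpM2l //; lra.
elim: j => [|j IHj] I i C f le_j insC f1 fw.
  rewrite expr0 mul1r addrC subrK; apply: le_avg => x.
  by case: (C x); rewrite ?mulr1 ?mulr0.
have [|X [g [g_bij cardX]]] := @exists_split I S.
  by rewrite (leq_trans _ le_j) // mulSn leq_addr.
have le_jX : (j * #|S| <= #|X|)%N.
  by rewrite cardX leq_subRL ?(leq_trans _ le_j) // mulSn ?leq_addr.
(* The choice is a function of the section alone: words [y] with equal sections get the same
   subspace. *)
pose pk (D : {set {ffun S -> option K}}) :=
  [pick w : {ffun S -> option K + 'I_N} |
    [forall c, exists s, w s == inr c] && [forall x, subspace w x \in D]].
have pkP D w : pk D = Some w -> nondeg w /\ forall x, subspace w x \in D.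
  rewrite /pk; case: pickP => // w' /andP[/forallP wn /forallP wD] [<-].
  by split=> // c; have /existsP[s /eqP ws] := wn c; exists s.
pose sec y := [set x | C (join g x y)].
pose rem x y := if pk (sec y) is Some w then x \in codom (subspace w) else false.
pose L x y := C (join g x y) && ~~ rem x y.
have rem_sub x y : rem x y -> C (join g x y).
  rewrite /rem; case def_w: (pk _) => [w|//] /codomP[v ->].
  by have [_ /(_ v)] := pkP _ _ def_w; rewrite inE.
have CE x y : (C (join g x y))%:R = (rem x y)%:R + (L x y)%:R :> R.
  have := @rem_sub x y; rewrite /L; case: (rem x y) => [->//|_] /=.
    by rewrite addr0.
  by rewrite andbT add0r.
have U0 : (0 < #|{: {ffun 'I_N -> option K}}|)%N by rewrite card_ffun expn_gt0 K1.
have rem_neg y : avg (fun x => f (join g x y) * (rem x y)%:R) <= 0.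
  rewrite /rem; case def_w: (pk _) => [w|].
    have [wn wC] := pkP _ _ def_w.
    rewrite (avg_codom (fun x => f (join g x y)) U0 (subspace_inj wn)).
    rewrite pmulr_rle0 //.
    have := fw (join g w (const_subspace _ y)) (join_nondegl _ g_bij wn).
    rewrite (eq_avg (g := fun u => f (join g (subspace w u) y))); last first.
      by move=> u; rewrite subspace_join subspace_const.
    apply=> u; rewrite subspace_join subspace_const.
    by have := wC u; rewrite inE.
  by apply: (avg_le [ffun=> None]) => x; rewrite mulr0.
have rem_big y : kap * (avg (fun x => (C (join g x y))%:R) - b) <=
    avg (fun x => (rem x y)%:R).
  have C1 : avg (fun x => (C (join g x y))%:R : R) <= 1.
    exact: (@avg_pred_le1 _ (fun x => C (join g x y))).
  have [dense|sparse] := lerP b (avg (fun x => (C (join g x y))%:R : R)); last first.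
    apply: (@le_trans _ _ 0); last by apply: avg_ge0.
    by rewrite pmulr_rle0 // subr_le0 ltW.
  have [|w wn wC] := hS i (fun x => C (join g x y)) _ dense.
    move=> x; apply: insensitive_eq insC _.
    by apply/ffunP => p; rewrite !ffunE; case: (g p) => // q; rewrite ffunE.
  rewrite /rem; case def_w': (pk _) => [w'|]; last first.
    move: def_w'; rewrite /pk; case: pickP => // /(_ w)/negP[].
    apply/andP; split; apply/forallP => c; last by rewrite inE.
    by apply/existsP; have [s ws] := wn c; exists s; rewrite ws.
  have [wn' _] := pkP _ _ def_w'.
  rewrite [leRHS](eq_avg (g := fun x => 1 * (x \in codom (subspace w'))%:R)); last first.
    by move=> x; rewrite mul1r.
  rewrite (avg_codom (fun=> 1) U0 (subspace_inj wn')) avg_cst //; last exact: [ffun=> None].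
  by rewrite ler_pM2l //; lra.
(* [y] and [fill i y] have the same section, so the leftover [L x] is insensitive and the induction
   hypothesis applies on the block [X]. *)
have L_small x : avg (fun y => f (join g x y) * (L x y)%:R) <=
    b + (1 - kap) ^+ j * (avg (fun y => (L x y)%:R) - b).
  apply: (IHj X i (L x) (fun y => f (join g x y))) => // [y|w wn wL].
    have CE' x' : C (join g x' (fill i y)) = C (join g x' y).
      by apply: insensitive_eq insC _; apply: fill_joinr.
    rewrite /L CE' /rem; suff -> : sec (fill i y) = sec y by [].
    by apply/setP => x'; rewrite !inE CE'.
  have := fw (join g (const_subspace _ x) w) (join_nondegr _ g_bij wn).
  rewrite (eq_avg (g := fun v => f (join g x (subspace w v)))); last first.
    by move=> u; rewrite subspace_join subspace_const.
  apply=> v; rewrite subspace_join subspace_const.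
  by have /andP[] := wL v.
rewrite !(avg_join _ g_bij).
have split_f : avg (fun x => avg (fun y => f (join g x y) * (C (join g x y))%:R)) =
   avg (fun y => avg (fun x => f (join g x y) * (rem x y)%:R)) +
   avg (fun x => avg (fun y => f (join g x y) * (L x y)%:R)).
  rewrite [X in _ = X + _]avg_exchange -avgD; apply: eq_avg => x.
  by rewrite -avgD; apply: eq_avg => y; rewrite CE mulrDr.
have split_C : avg (fun x => avg (fun y => (C (join g x y))%:R : R)) =
   avg (fun y => avg (fun x => (rem x y)%:R)) +
   avg (fun x => avg (fun y => (L x y)%:R)).
  rewrite [X in _ = X + _]avg_exchange -avgD; apply: eq_avg => x.
  by rewrite -avgD; apply: eq_avg => y; rewrite CE.
have rem_le0 : avg (fun y => avg (fun x => f (join g x y) * (rem x y)%:R)) <= 0.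
  exact: (avg_le [ffun=> None]).
have rem_ge : kap * (avg (fun x => avg (fun y => (C (join g x y))%:R)) - b) <=
    avg (fun y => avg (fun x => (rem x y)%:R)).
  rewrite avg_exchange; apply: le_trans (le_avg rem_big).
  by rewrite avgMl avgB (avg_cst [ffun=> None]).
have L_le : avg (fun x => avg (fun y => f (join g x y) * (L x y)%:R)) <=
    b + (1 - kap) ^+ j * (avg (fun x => avg (fun y => (L x y)%:R)) - b).
  apply: le_trans (le_avg L_small) _.
  by rewrite avgD avg_cst ?avgMl ?avgB ?avg_cst //; exact: [ffun=> None].
rewrite split_f; apply: le_trans (lerD rem_le0 L_le) _.
rewrite add0r lerD2l exprSr -mulrA ler_wpM2l ?exprn_ge0 ?subr_ge0 //.
by lra.
Qed.

(** Induction on [s]: the complement of the intersection is the disjoint union of the complement of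
    [C a], which is itself insensitive, and the part of [C a] outside the remaining sets. The latter
    is treated on subspaces of [C a] large enough for the induction hypothesis. *)
Lemma insensitive_complement_avg_le K (k0 : K) :
  (forall N (d : R), 0 < d -> MDHJ K N d) ->
  forall (s : seq K) N (eps : R), 0 < eps -> exists m,
  forall I (C : K -> pred {ffun I -> option K}) (f : {ffun I -> option K} -> R),
    (m <= #|I|)%N -> (forall a, insensitive a (C a)) -> (forall x, f x <= 1) ->
    (forall w : {ffun I -> option K + 'I_N}, nondeg w ->
      avg (fun x => f (subspace w x)) <= 0) ->
    avg (fun x => f x * (1 - (all (C^~ x) s)%:R)) <= eps.
Proof.
move=> md; elim=> [|a s IHs] N eps eps0.
  exists 0%N => I C f _ _ _ _; apply: (avg_le [ffun=> None]) => x /=.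
  by rewrite subrr mulr0 ltW.
have e30 : 0 < eps / 3 by lra.
have [N' hN'] := IHs N _ e30.
have [m1 hm1] := insensitive_avg_le k0 md N e30.
have [m2 hm2] := insensitive_avg_le k0 md N' e30.
exists (maxn m1 m2) => I C f; rewrite geq_max => /andP[le1 le2] insC f1 fw.
pose rest x : R := (all (C^~ x) s)%:R.
(* Subtracting [eps / 3] turns the bound of the induction hypothesis into a nonpositive average on
   each subspace of dimension [N']. *)
pose h x := f x * (1 - rest x) - eps / 3.
have outside : avg (fun x => f x * (predC (C a) x)%:R) <= eps / 3.
  apply: (hm1 I a _ f le1) => // [x|w wn _]; last exact: fw.
  by rewrite /= insC.
have inside : avg (fun x => h x * (C a x)%:R) <= eps / 3.
  apply: (hm2 I a _ h le2) => // [x|w wn wC].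
    rewrite /h /rest; have := f1 x.
    by case: (all _ _); rewrite ?subrr ?mulr0 ?subr0 ?mulr1; lra.
  rewrite avgB (avg_cst [ffun=> None]) subr_le0.
  apply: (hN' _ (fun a x => C a (subspace w x)) (fun x => f (subspace w x))) => //.
  - by rewrite card_ord.
  - by move=> a' x; apply: insensitive_eq (insC a') _; apply: fill_subspace.
  move=> w' wn'; have := fw _ (subspace_comp_nondeg wn wn').
  by under eq_avg do rewrite subspace_compE.
have Ca1 : avg (fun x => (C a x)%:R : R) <= 1 by apply: avg_pred_le1.
have -> : avg (fun x => f x * (1 - (all (C^~ x) (a :: s))%:R)) =
    avg (fun x => f x * (predC (C a) x)%:R) +
    (avg (fun x => h x * (C a x)%:R) + eps / 3 * avg (fun x => (C a x)%:R)).
  rewrite -avgMl -!avgD; apply: eq_avg => x; rewrite /h /rest /=.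
  by case: (C a x) => /=; lra.
have : eps / 3 * avg (fun x => (C a x)%:R) <= eps / 3 * 1 by rewrite ler_wpM2l // ltW.
by lra.
Qed.

End DensityHalesJewett.

(** * The density increment *)

Section DensityHalesJewettStep.
Variable R : realType.
Implicit Types I J K X S : finType.

(* A random subspace over [K] contains a line common to many sections [A _ y].
   Pigeonholing the line [l] and freezing the letters outside a copy of
   [option K] turns the random subspace into a uniform word over [option K]. *)
Lemma many_common_lines K (k0 : K) (d : R) : 0 < d -> DHJ K (d / 2 / 2) ->
  exists2 theta : R, 0 < theta & forall S, exists M : finType,
  forall (Y : finType) (y0 : Y) (A : {ffun M -> option K} -> Y -> bool),
    (forall x : {ffun M -> K}, d / 2 <= avg (fun y => (A [ffun p => Some (x p)] y)%:R)) ->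
  exists (e : S -> M) (u : {ffun M -> option K}), injective e /\
    theta <= avg (fun v => avg (fun y =>
      [forall a, A (fill a (subspace (insertion e u) v)) y]%:R)).
Proof.
move=> d0 [n0 hn0]; pose U := {ffun 'I_n0 -> option K}.
have d40 : 0 < d / 2 / 2 by lra.
have U0 : 0 < #|{: U}|%:R :> R by rewrite ltr0n; apply/card_gt0P; exists [ffun=> None].
set t := d / 2 / 2 / #|{: U}|%:R.
have t0 : 0 < t by rewrite divr_gt0.
have t20 : 0 < t / 2 by lra.
exists (t / 2) => // S.
have [M [_ rare]] := @rare_few_occurrences R (K + 'I_n0)%type #|S| _ t20.
exists M => Y y0 A dA.
pose P (p : {ffun M -> K + 'I_n0} * Y) (l : U) := [exists j, l j == None] &&
  [forall a, A [ffun q => Some (subspace p.1 (line l a) q)] p.2].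
have dP : d / 2 / 2 <= avg (fun p => [exists l, P p l]%:R).
  rewrite avg_pair; apply: (avg_ge [ffun=> inl k0]) => w.
  pose F y := avg (fun v => (A [ffun q => Some (subspace w v q)] y)%:R : R).
  have dF : d / 2 <= avg F.
    by rewrite avg_exchange; apply: (avg_ge [ffun=> k0]) => v; apply: dA.
  apply: le_trans (avg_popular _ dF) _.
    by move=> y; apply: (@avg_pred_le1 R _ (fun v => A [ffun q => Some (subspace w v q)] y)).
  apply: le_avg => y; case: (lerP (d / 2 / 2) _) => /= dy; last exact: ler0n.
  rewrite ler_nat lt0b.
  have [|l [j lj] Al] := hn0 _ (fun v => A [ffun q => Some (subspace w v q)] y) _ dy.
    by rewrite card_ord.
  apply/existsP; exists l; apply/andP; split; last exact/forallP.
  by apply/existsP; exists j; rewrite lj.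
have [l dl] := exists_pigeonhole ([ffun=> inl k0], y0) d40 dP.
have [j0 lj0] : exists j, l j = None.
  have [p] := exists_ge_avg ([ffun=> inl k0], y0) dl; rewrite /P.
  case: existsP => [[j /eqP]|_ /=]; first by exists j.
  by rewrite -/t; lra.
pose good x := avg (fun y => [forall a, A (fill a x) y]%:R : R).
(* Substituting [l] sends the letter [inr j0] to [None] and [inl a] to [Some a], so the positions of
   [w] with letters in the range of [g] become a uniform word over [option K]. *)
pose g (c : option K) : K + 'I_n0 := if c is Some a then inl a else inr j0.
have g_inj : injective g by move=> [a|] [b|] // [->].
have : t <= avg (fun w => good (subspace_line w l)).
  apply: le_trans dl _; rewrite avg_pair; apply: le_avg => w; apply: le_avg => y.
  rewrite /P ler_nat /=; case: [exists j, _] => //=.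
  apply/eq_leq; congr nat_of_bool; apply: eq_forallb => a; congr (A _ y).
  by rewrite -subspace_lineE; apply/ffunP => p; rewrite !ffunE.
rewrite (avg_remix None _ g_inj); set f := (fun w => avg _) => tf.
have {}rare := rare (mem (codom g)) (ex_intro _ (g None) (codom_f g None)).
set few := (fun w => _) in rare.
have [w tw] : exists w, t / 2 <= f w - few w.
  by apply: (exists_ge_avg [ffun=> inl k0]); rewrite avgB; lra.
have f1 : f w <= 1.
  apply: (avg_le [ffun=> None]) => x.
  by apply: (@avg_pred_le1 R _ (fun y => [forall a, A (fill a _) y])).
have [le_S] : (#|S| <= #|[pred p | w p \in codom g]|)%N /\ t / 2 <= f w.
  move: tw; rewrite /few; case: ltnP => /= [_|le_S]; first by lra.
  by move=> tw; split=> //; lra.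
pose e (s : S) : M := enum_val (widen_ord le_S (enum_rank s)).
have e_inj : injective e.
  by move=> s s' /enum_val_inj/(congr1 val)/= /val_inj/enum_rank_inj.
have e_codom s : w (e s) \in codom g by have := enum_valP (widen_ord le_S (enum_rank s)).
rewrite /f (avg_insertion None _ e_inj) => /(exists_ge_avg [ffun=> None])[u du].
(* Positions outside the range of [g] are frozen at the letter that [l] gives them. *)
pose u' : {ffun M -> option K} :=
  [ffun p => if w p \in codom g then u p else subspace_line w l p].
exists e, u'; split=> //; apply: le_trans du _; apply: le_avg => v.
rewrite /good; suff -> : subspace_line (remix g w (subspace (insertion e u) v)) l =
    subspace (insertion e u') v by [].
have gE c : match g c with inl a => Some a | inr j => l j end = c by case: c.
apply/ffunP => p; rewrite ffunE ffunE [in RHS]ffunE ffunE [in RHS]ffunE.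
rewrite [in LHS]ffunE; case: pickP => [s /eqP<-|ep]; first by rewrite e_codom gE.
by rewrite ffunE; case: ifP => _; rewrite ?gE ?ffunE.
Qed.

(** If one value were smaller, the other values, each at most [c + eta], could not restore the
    average. *)
Lemma avg_near_max (T : finType) (f : T -> R) c eta x : 0 <= eta ->
  (forall z, f z <= c + eta) -> c - eta <= avg f -> c - 2 * eta * #|T|%:R <= f x.
Proof.
move=> eta0 f_le; have T0 : (0 < #|T|)%N by apply/card_gt0P; exists x.
rewrite /avg ler_pdivlMr ?ltr0n // (bigD1 x) //=.
have : \sum_(z | z != x) f z <= \sum_(z | z != x) (c + eta) by apply: ler_sum.
rewrite sumr_const cardC1 -[_ *+ _]mulr_natr.
have -> : #|T|.-1%:R = #|T|%:R - 1 :> R by rewrite -subn1 natrB.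
by lra.
Qed.

Lemma dhj_step K (k0 : K) (d : R) : (forall d' : R, 0 < d' -> DHJ K d') -> 0 < d ->
  (forall d' : R, d < d' -> DHJ (option K) d') ->
  exists2 eta : R, 0 < eta & DHJ (option K) (d - eta).
Proof.
move=> dhjK d0 dhj_gt; have md := mdhj k0 dhjK.
have d40 : 0 < d / 2 / 2 by lra.
have [theta theta0 rich] := many_common_lines k0 d0 (dhjK _ d40).
have dtheta0 : 0 < d * theta by rewrite mulr_gt0.
(* At the end [D] contributes at least [(d + b) * theta >= 8 * b], the errors cost [3 * b], and the
   total should be at most [b]. The constant [theta] precedes the choice of [S] and [M]. *)
pose b := d * theta / 8; have b0 : 0 < b by rewrite /b; lra.
have [N hN] := dhj_gt (d + b) ltac:(lra).
have [m hm] := insensitive_complement_avg_le k0 md (enum K) N b0.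
(* The [1] makes words without [None] rare; such words are not lines over [K]. *)
have [S [le_mS rareS]] := @rare_few_occurrences R (option K) (maxn m 1) _ b0.
have {}le_mS : (m <= #|S|)%N by rewrite (leq_trans _ le_mS) ?leq_maxl.
have [M hM] := rich S.
pose Q : R := #|{: {ffun M -> option K}}|%:R.
have Q0 : 0 < Q by rewrite ltr0n; apply/card_gt0P; exists [ffun=> None].
(* By [avg_near_max], each section over [M] then has density at least [d - b], for the final count,
   and at least [d / 2], as [hM] demands. *)
pose eta := Num.min b (d / 2) / (2 * Q).
have eta0 : 0 < eta.
  by rewrite divr_gt0 ?mulr_gt0 // lt_min b0; lra.
have etaQ : 2 * eta * Q <= b /\ 2 * eta * Q <= d / 2.
  have -> : 2 * eta * Q = Num.min b (d / 2).
    by rewrite mulrAC mulrC /eta mulfVK // mulf_neq0 ?gt_eqF.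
  by rewrite !ge_min !lexx orbT.
have [n' hn'] := dhj_gt (d + eta) ltac:(lra).
exists eta => //; exists (#|M| + n')%N => I A le_n dA.
have [/existsP[l /andP[/existsP[i /eqP li] /forallP Al]]|/existsPn noline] :=
    boolP [exists l : {ffun I -> option (option K)},
      [exists i, l i == None] && [forall a, A (line l a)]].
  by exists l => //; exists i.
suff : False by [].
have nosub (J : finType) (W : {ffun I -> option K + J}) (l : {ffun J -> option (option K)}) j :
    nondeg W -> l j = None -> (forall a, A (subspace W (line l a))) -> False.
  move=> Wn lj Al; have /negP[] := noline (subspace_line W l).
  apply/andP; split; last by apply/forallP => a; rewrite subspace_lineE.
  by apply/existsP; have [i Wi] := Wn j; exists i; rewrite ffunE Wi lj.
have [|X [g [g_bij cardX]]] := @exists_split I M.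
  by rewrite (leq_trans _ le_n) ?leq_addr.
have le_n'X : (n' <= #|X|)%N.
  by rewrite cardX leq_subRL ?(leq_trans _ le_n) // ?leq_addr.
pose Y := {ffun X -> option K}.
have id_nondeg (J : finType) : nondeg ([ffun j => inr j] : {ffun J -> option K + J}).
  by move=> j; exists j; rewrite ffunE.
have id_sub (J : finType) (x : {ffun J -> option K}) : subspace [ffun j => inr j] x = x.
  by apply/ffunP => j; rewrite !ffunE.
pose F (x : {ffun M -> option K}) := avg (fun y : Y => (A (join g x y))%:R : R).
have F_lt x : F x <= d + eta.
  rewrite leNgt; apply/negP => /ltW dF.
  have [l [j lj] Al] := hn' _ (fun y => A (join g x y)) le_n'X dF.
  apply: (nosub _ (join g (const_subspace _ x) [ffun j => inr j]) l j) => //.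
    exact: join_nondegr.
  by move=> a; rewrite subspace_join subspace_const id_sub.
have F_ge x : d - 2 * eta * Q <= F x.
  apply: avg_near_max => //; first exact: ltW.
  by move: dA; rewrite (avg_join _ g_bij).
have [|e [u [e_inj le_theta]]] := hM {: Y} [ffun=> None] (fun x y => A (join g x y)).
  by move=> x; apply: le_trans (F_ge _); lra.
pose emb := subspace (insertion e u).
pose C y a v := A (join g (fill a (emb v)) y).
pose f y v : R := (A (join g (emb v) y))%:R - (d + b).
pose D v y := [forall a, C y a v].
have small y : avg (fun v => f y v * (1 - (D v y)%:R)) <= b.
  rewrite (eq_avg (g := fun v => f y v * (1 - (all (C y ^~ v) (enum K))%:R))); last first.
    move=> v; congr (_ * (1 - (nat_of_bool _)%:R)); apply/forallP/allP => [Ca a _ //|Ca a].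
    by apply: Ca; rewrite mem_enum.
  apply: hm => // [a v|v|w wn].
  - by congr (A (join g _ y)); apply: fill_subspace.
  - by rewrite /f; case: (A _) => /=; lra.
  (* A positive average of [f y] on a subspace would mean density above [d + b] there, hence a line
     in [A]. *)
  rewrite avgB (avg_cst [ffun=> None]) subr_le0 leNgt; apply/negP => /ltW dw.
  have [|l [j lj] Al] := hN _ (fun x => A (join g (emb (subspace w x)) y)) _ dw.
    by rewrite card_ord.
  apply: (nosub _ (join g (subspace_comp (insertion e u) w) (const_subspace _ y)) l j) => //.
    by apply: join_nondegl => //; apply: subspace_comp_nondeg => //; apply: insertion_nondeg.
  by move=> a; rewrite subspace_join subspace_const subspace_compE.
have fewD v y : ((A (join g (emb v) y)) && D v y)%:R <=
    (#|[pred p | v p == None]| < maxn m 1)%N%:R :> R.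
  rewrite ler_nat; case: ltnP => [_|]; first exact: leq_b1.
  rewrite geq_max => /andP[_ /card_gt0P[p /eqP vp]].
  rewrite leqn0 eqb0; apply/negP => /andP[Av /forallP Dv].
  (* The line whose wildcards are the [None] of [emb v]: its point at [None] is [emb v] itself, and
     its point at [Some a] is [fill a (emb v)]. *)
  pose l : {ffun M -> option (option K)} := [ffun q => omap Some (emb v q)].
  apply: (nosub _ (join g [ffun j => inr j] (const_subspace _ y)) l (e p)).
  - exact: join_nondegl.
  - by rewrite ffunE ffunE insertionE // vp.
  move=> [a|]; rewrite subspace_join subspace_const id_sub; last first.
    by congr (A (join g _ y)): Av; apply/ffunP => q; rewrite [RHS]ffunE [l q]ffunE;
       case: (emb v q).
  by congr (A (join g _ y)): (Dv a); apply/ffunP => q; rewrite ffunE [RHS]ffunE [l q]ffunE;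
    case: (emb v q).
have D_A : avg (fun v => avg (fun y => ((A (join g (emb v) y)) && D v y)%:R : R)) <= b.
  apply: le_trans (rareS (pred1 None) (ex_intro _ None (eqxx _))).
  by apply: le_avg => v; apply: (avg_le [ffun=> None]) => y; apply: fewD.
have A_ge : d - b <= avg (fun v => F (emb v)).
  by apply: (avg_ge [ffun=> None]) => v; apply: le_trans (F_ge _); lra.
have : avg (fun v => avg (fun y => f y v * (1 - (D v y)%:R))) <= b.
  by rewrite avg_exchange; apply: (avg_le [ffun=> None]).
have -> : avg (fun v => avg (fun y => f y v * (1 - (D v y)%:R))) =
    avg (fun v => F (emb v)) - (d + b)
    - avg (fun v => avg (fun y => ((A (join g (emb v) y)) && D v y)%:R))
    + (d + b) * avg (fun v => avg (fun y => (D v y)%:R)).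
  rewrite -avgMl -{1}(avg_cst ([ffun=> None] : {ffun S -> option K}) (d + b)).
  rewrite -!avgB -avgD; apply: eq_avg => v.
  rewrite /F -avgMl -(avg_cst ([ffun=> None] : Y) (d + b)) -!avgB -avgD.
  apply: eq_avg => y; rewrite avg_cst /f; last exact: [ffun=> None].
  by case: (A _); case: (D v y) => /=; lra.
move: le_theta; rewrite -/emb -/(D _ _).
set s := avg (fun v => avg (fun y => [forall a, _]%:R)) => le_theta.
rewrite -/s.
have : (d + b) * theta <= (d + b) * s by rewrite ler_wpM2l // addr_ge0 ?ltW.
have : 0 <= b * theta by rewrite mulr_ge0 // ltW.
rewrite mulrDl; have : d * theta = 8 * b by rewrite /b; lra.
by lra.
Qed.
End DensityHalesJewettStep.

(** * The density Hales-Jewett theorem *)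

Section DensityHalesJewettTheorem.
Variable R : realType.
Implicit Types I J K X S : finType.

Lemma dhj_mono K (d d' : R) : d <= d' -> DHJ K d -> DHJ K d'.
Proof. by move=> dd' [n hn]; exists n => I A nI /(le_trans dd'); apply: hn. Qed.

Lemma dhj_option K (k0 : K) : (forall d : R, 0 < d -> DHJ K d) ->
  forall d : R, 0 < d -> DHJ (option K) d.
Proof.
move=> dhjK; pose E : set R := [set d | 0 < d /\ DHJ (option K) d]%classic.
(* No set has density 2, so the condition is vacuous and [E] is nonempty. *)
have E2 : E 2.
  split=> //; exists 0%N => I A _ /le_trans/(_ (avg_pred_le1 _ _)).
  by lra.
have E_lb : lbound E 0 by move=> d [/ltW].
have E_inf : has_inf E by split; [exists 2|exists 0].
have dhj_gt d : inf E < d -> DHJ (option K) d.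
  move=> /(inf_lt (proj1 E_inf))[d' [_ dhj_d'] d'd].
  exact: dhj_mono (ltW d'd) dhj_d'.
have inf0 : 0 <= inf E by apply: lb_le_inf => //; exists 2.
move: inf0; rewrite le_eqVlt => /predU1P[inf0 d d0|inf0].
  by apply: dhj_gt; rewrite -inf0.
have [eta eta0 dhj_lt] := dhj_step k0 dhjK inf0 dhj_gt.
(* The maximum with [inf E / 2] keeps the density positive while staying below the infimum, a
   contradiction. *)
have : E (Num.max (inf E - eta) (inf E / 2)).
  split; first by rewrite lt_max; apply/orP; right; lra.
  by apply: dhj_mono dhj_lt; rewrite le_max lexx.
move=> /(ge_inf (proj2 E_inf)); rewrite le_max => /orP[]; lra.
Qed.

Lemma dhj_unit (d : R) : 0 < d -> DHJ unit d.
Proof.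
move=> d0; exists 1%N => I A /card_gt0P[i _] dA.
have [x dx] := exists_ge_avg [ffun=> tt] dA.
exists [ffun=> None] => [|a]; first by exists i; rewrite ffunE.
have -> : line [ffun=> None] a = x by apply/ffunP => j; case: (line _ _ _) (x j) => [] [].
by apply: contraTT d0 => /negbTE Ax; move: dx; rewrite Ax /= -leNgt.
Qed.

Lemma dhj_bij K X (h : K -> X) (d : R) : bijective h -> DHJ K d -> DHJ X d.
Proof.
case=> h' hK h'K [n hn]; exists n => I A nI dA.
pose s (x : {ffun I -> K}) : {ffun I -> X} := [ffun i => h (x i)].
have s_bij : bijective s.
  exists (fun x : {ffun I -> X} => [ffun i => h' (x i)]) => x.
    by apply/ffunP => i; rewrite !ffunE hK.
  by apply/ffunP => i; rewrite !ffunE h'K.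
have [|l [i li] Al] := hn I (fun x => A (s x)) nI.
  by rewrite (avg_bij (fun x => (A x)%:R) s_bij).
exists [ffun j => omap h (l j)] => [|a]; first by exists i; rewrite ffunE li.
suff <- : s (line l (h' a)) = line [ffun j => omap h (l j)] a by [].
by apply/ffunP => j; rewrite !ffunE; case: (l j) => //=.
Qed.

(** Up to a bijection, a nonempty alphabet is obtained from [unit] by iterating [option]. *)
Theorem density_hales_jewett K (k0 : K) (d : R) : 0 < d -> DHJ K d.
Proof.
move=> d0; suff [X [cardX dhjX]] : exists X, #|X| = #|K| /\ DHJ X d.
  apply: (dhj_bij (h := fun x => enum_val (cast_ord cardX (enum_rank x)))) dhjX.
  exists (fun s => enum_val (cast_ord (esym cardX) (enum_rank s))) => i.
    by rewrite enum_valK cast_ordK enum_rankK.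
  by rewrite enum_valK cast_ordKV enum_rankK.
have [n ->] : exists n, #|K| = n.+1.
  by have /card_gt0P := ex_intro xpredT k0 isT; case: #|K| => // n; exists n.
suff [X [x0 [cardX dhjX]]] : exists (X : finType) (x0 : X),
    #|X| = n.+1 /\ forall d : R, 0 < d -> DHJ X d by exists X; split=> //; apply: dhjX.
elim: n => [|n [X [x0 [cardX dhjX]]]].
  by exists unit, tt; split; [rewrite card_unit|exact: dhj_unit].
by exists (option X), None; split; [rewrite card_option cardX|exact: dhj_option].
Qed.

(** * Patterns in finite abelian groups *)

Lemma addr_bij (V : zmodType) (c : V) : bijective (fun x => x + c).
Proof. by exists (fun x => x - c) => x; rewrite ?addrK ?subrK. Qed.

Theorem affine_patterns_avg_ge K (k0 : K) (d : R) : 0 < d ->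
  exists2 c : R, 0 < c &
  forall (J : finType) (U : finZmodType) (T : K -> {ffun J -> U} -> {ffun J -> U}),
    (forall a, {morph T a : x y / x + y}) ->
  forall phi : {ffun J -> U} -> R, (forall x, 0 <= phi x <= 1) -> d <= avg phi ->
  c <= avg (fun fg : {ffun J -> U} * {ffun J -> U} => \prod_a phi (fg.1 + T a fg.2)).
Proof.
move=> d0; have d20 : 0 < d / 2 by lra.
have d40 : 0 < d / 2 / 2 by lra.
have [n hn] := density_hales_jewett k0 d40.
pose L := {ffun 'I_n -> option K}.
have L0 : 0 < #|{: L}|%:R :> R by rewrite ltr0n; apply/card_gt0P; exists [ffun=> None].
(* The power bounds the product when all its factors are popular values; the other factor is the
   pigeonhole density of one line [l]. *)
exists ((d / 2) ^+ #|K| * (d / 2 / 2 / #|{: L}|%:R)).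
  by rewrite mulr_gt0 ?exprn_gt0 // divr_gt0.
move=> J U T T_add phi phi01 d_phi.
pose V := {ffun J -> U}.
pose A (v : V) := d / 2 <= phi v.
have dA : d / 2 <= avg (fun v => (A v)%:R).
  by apply: avg_popular => // x; have /andP[] := phi01 x.
have avg_shift (h : V -> R) (c : V) : avg (fun v : V => h (v + c)) = avg h.
  exact: (avg_bij h (addr_bij c)).
have T0 a : T a 0 = 0.
  by apply: (@addrI _ (T a 0)); rewrite -T_add !addr0.
pose pt (p : V * {ffun 'I_n -> V}) (x : {ffun 'I_n -> K}) : V :=
  p.1 + \sum_i T (x i) (p.2 i).
pose P p (l : L) := [exists i, l i == None] && [forall a, A (pt p (line l a))].
have dF : d / 2 <= avg (fun p => avg (fun x => (A (pt p x))%:R : R)).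
  rewrite avg_exchange; apply: (avg_ge [ffun=> k0]) => x.
  rewrite avg_pair avg_exchange; apply: (avg_ge (0 : {ffun 'I_n -> V})) => D.
  by rewrite -(avg_shift _ (\sum_i T (x i) (D i))) in dA.
have dP : d / 2 / 2 <= avg (fun p => [exists l, P p l]%:R).
  apply: le_trans (avg_popular _ dF) _.
    by move=> p; apply: (@avg_pred_le1 R _ (fun x => A (pt p x))).
  apply: le_avg => p; case: (lerP (d / 2 / 2) _) => /= dy; last exact: ler0n.
  rewrite ler_nat lt0b.
  have [|l [j lj] Al] := hn _ (fun x => A (pt p x)) _ dy; first by rewrite card_ord.
  apply/existsP; exists l; apply/andP; split; last exact/forallP.
  by apply/existsP; exists j; rewrite lj.
have p0 : V * {ffun 'I_n -> V} := (0, 0).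
have [l dl] := exists_pigeonhole p0 d40 dP.
have [i0 li0] : exists i, l i = None.
  have [p] := exists_ge_avg p0 dl; rewrite /P.
  case: existsP => [[j /eqP]|_ /=]; first by exists j.
  by have := divr_gt0 d40 L0; lra.
(* Along [l], the wildcards sum to the common difference [step D], and the fixed letters to the
   translation [base D]. *)
pose step (D : {ffun 'I_n -> V}) : V := \sum_(i | l i == None) D i.
pose base (D : {ffun 'I_n -> V}) : V :=
  \sum_(i | l i != None) T (odflt k0 (l i)) (D i).
pose H (f g : V) := [forall a, A (f + T a g)].
have ptE f D a : pt (f, D) (line l a) = f + base D + T a (step D).
  rewrite /pt /= (bigID (fun i => l i == None)) /= -addrA; congr (_ + _).
  rewrite addrC; congr (_ + _).
    by apply: eq_bigr => i; rewrite ffunE; case: (l i).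
  by rewrite (big_morph _ (T_add a) (T0 a)); apply: eq_bigr => i /eqP li; rewrite ffunE li.
(* [step D] is uniform: adding [v] to [D] at the wildcard [i0] translates it by [v]. *)
have avg_step (h : V -> R) : avg (fun D => h (step D)) = avg h.
  transitivity (avg (fun v => avg (fun D => h (step D + v)))); last first.
    rewrite avg_exchange.
    transitivity (avg (fun D : {ffun 'I_n -> V} => avg h)).
      apply: eq_avg => D; rewrite -[RHS](avg_shift h (step D)).
      by apply: eq_avg => v; rewrite addrC.
    by rewrite (avg_cst (0 : {ffun 'I_n -> V})).
  rewrite -[LHS](avg_cst (0 : V)); apply: eq_avg => v.
  pose del : {ffun 'I_n -> V} := [ffun i => if i == i0 then v else 0].
  rewrite -(avg_bij (fun D => h (step D)) (addr_bij del)).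
  apply: eq_avg => D; congr h; rewrite /step; under eq_bigr do rewrite ffunE.
  rewrite big_split /=; congr (_ + _); rewrite (bigD1 i0) ?li0 //= ffunE eqxx.
  by rewrite big1 ?addr0 // => i /andP[_ /negbTE ii0]; rewrite ffunE ii0.
have dH : d / 2 / 2 / #|{: L}|%:R <= avg (fun fg : V * V => (H fg.1 fg.2)%:R).
  apply: le_trans dl _.
  apply: (@le_trans _ _ (avg (fun p : V * {ffun 'I_n -> V} =>
      (H (p.1 + base p.2) (step p.2))%:R))).
    apply: le_avg => -[f D]; rewrite /P ler_nat; case: [exists i, _] => //=.
    rewrite /H; apply/eq_leq; congr nat_of_bool.
    by apply: eq_forallb => a; rewrite ptE.
  rewrite avg_pair avg_exchange avg_pair [leRHS]avg_exchange -[leRHS]avg_step.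
  apply: le_avg => D /=.
  by rewrite -[leRHS](avg_shift _ (base D)).
apply: le_trans (_ : (d / 2) ^+ #|K| * avg (fun fg : V * V => (H fg.1 fg.2)%:R) <= _).
  by rewrite ler_wpM2l // exprn_ge0 // ltW.
rewrite -avgMl; apply: le_avg => -[f g] /=.
case: (boolP (H f g)) => [/forallP Hfg|_] /=; last first.
  by rewrite mulr0 prodr_ge0 // => a _; have /andP[] := phi01 (f + T a g).
rewrite mulr1 -prodr_const; apply: ler_prod => a _.
by rewrite (ltW d20); apply: Hfg.
Qed.

End DensityHalesJewettTheorem.

(** * Polynomials modulo [fam N] *)

Lemma polyGD (F : finFieldType) N (f g : {ffun 'I_N -> F}) :
  polyG (f + g) = polyG f + polyG g.
Proof.
apply/polyP => i; rewrite coefD !coef_poly; case: ifP => [iN|_]; last by rewrite addr0.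
by rewrite insubT ffunE.
Qed.

Lemma polyGK (F : finFieldType) N : cancel (@polyG F N) (@ofPoly F N).
Proof.
move=> f; apply/ffunP => i; rewrite ffunE coef_poly ltn_ord.
by rewrite (valK i).
Qed.

Lemma ofPolyD (F : finFieldType) N (p q : {poly F}) :
  ofPoly N (p + q) = ofPoly N p + ofPoly N q.
Proof. by apply/ffunP => i; rewrite !ffunE coefD. Qed.

Theorem mainTheorem2 (F : finFieldType) (R : realType) (k : nat)
    (fam : nat -> {poly F}) :
  (0 < k)%N ->
  (forall N : nat, (0 < N)%N ->
     [/\ fam N \is monic, size (fam N) = N.+1 & irreducible_poly (fam N)]) ->
  forall delta : R, 0 < delta ->
  exists c : R, 0 < c /\
    forall (N : nat), (k <= N)%N ->
    forall phi : {ffun 'I_N -> F} -> R,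
      (forall x, 0 <= phi x <= 1) ->
      delta <= avg phi ->
      c <= avg (fun fg : {ffun 'I_N -> F} * {ffun 'I_N -> F} =>
             \prod_(P : {ffun 'I_k -> F})
                phi (ofPoly N ((polyG fg.1 + polyG P * polyG fg.2) %% fam N))).
Proof.
move=> k0 famP delta delta0.
have [c c0 hc] := affine_patterns_avg_ge (0 : {ffun 'I_k -> F}) delta0.
exists c; split=> // N kN phi phi01 d_phi.
have [_ size_fam _] := famP N (leq_trans k0 kN).
(* Multiplication by [P] in the field, an additive map of [g]; the constant [c] depends on [k]
   through the alphabet of all [P], but not on [N]. *)
pose T (P : {ffun 'I_k -> F}) (g : {ffun 'I_N -> F}) :=
  ofPoly N ((polyG P * polyG g) %% fam N).
have T_add P : {morph T P : x y / x + y}.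
  by move=> x y; rewrite /T polyGD mulrDr modpD ofPolyD.
apply: le_trans (hc _ _ _ T_add _ phi01 d_phi) _.
apply: le_avg => -[f g] /=; rewrite le_eqVlt; apply/orP; left; apply/eqP.
apply: eq_bigr => P _; congr phi; rewrite modpD ofPolyD modp_small ?polyGK //.
by rewrite size_fam ltnS size_poly.
Qed.
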